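(* Let $G$ and $H$ be finite groups. If $\varphi\colon\underline{R}\to\underline{T}$ is an $H$-Galois extension of $G$-Tambara functors, then $\underline{T}$ is separable over $\underline{R}$.
   Context: $\Box$ is the box product of $G$-Mackey functors, and $\underline{T}\Box_{\underline{R}}\underline{T}$ is the relative box product (the coequalizer of the two $\underline{R}$-actions on $\underline{T}\Box\underline{R}\Box\underline{T}\rightrightarrows\underline{T}\Box\underline{T}$), again a $G$-Tambara functor. Let $\mu\colon\underline{T}\Box_{\underline{R}}\underline{T}\to\underline{T}$ be the multiplication map. A monomorphism $\varphi\colon\underline{R}\to\underline{T}$ of $G$-Tambara functors is an $H$-Galois extension of $G$-Tambara functors if: (1) $H$ acts on the left on $\underline{T}$ through $\underline{R}$-algebra maps in $G$-Tambara functors; (2) $\varphi$ induces an isomorphism $\underline{R}\cong\underline{T}^H$, i.e. $\varphi_K\colon\underline{R}(G/K)\to\underline{T}(G/K)^H$ is an isomorphism for all subgroups $K$ of $G$; (3) the map $\chi\colon\underline{T}\Box_{\underline{R}}\underline{T}\to\prod_H\underline{T}$ whose component at $h\in H$ is $\mu\circ(\mathrm{id}\Box h)$ is an isomorphism of $G$-Tambara functors (products are formed levelwise). $\underline{T}$ is separable over $\underline{R}$ if $\mu$ has a section $s\colon\underline{T}\to\underline{T}\Box_{\underline{R}}\underline{T}$ which is a map of $\underline{T}$-bimodules over $\underline{R}$. *)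

(* Defs.v *)
From HB Require Import structures.
From mathcomp Require Import all_boot all_order all_fingroup all_algebra.

Set Implicit Arguments.
Unset Strict Implicit.
Unset Printing Implicit Defensive.

Import GRing.Theory.
Local Open Scope ring_scope.

(* MathComp registers this for nonzero rings only. Tambara functors need the  *)
(* zero ring, which is their value on the empty G-set.                        *)
HB.instance Definition _ (I : finType) (A : comPzRingType) :=
  GRing.PzRing_hasCommutativeMul.Build {ffun I -> A} (@ffun_mulC I A).

(* MathComp actions are right actions; letting g act as g^-1 turns right      *)
(* G-sets into left G-sets, and the right cosets of K into G/K.               *)
Record gset (G : finGroupType) := GSet {
  gset_sort :> finType;
  gset_act : {action G &-> gset_sort}
}.

Record gmap (G : finGroupType) (X Y : gset G) := GMap {
  gmap_fun :> X -> Y;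
  gmap_equiv : forall x g, gmap_fun (gset_act X x g) = gset_act Y (gmap_fun x) g
}.

Section GSets.
Variable G : finGroupType.
Implicit Types X Y Z W A : gset G.

Definition gid X : gmap X X := @GMap G X X id (fun _ _ => erefl).

Lemma gcomp_equiv X Y Z (g : gmap Y Z) (f : gmap X Y) x a :
  g (f (gset_act X x a)) = gset_act Z (g (f x)) a.
Proof. by rewrite !gmap_equiv. Qed.
Definition gcomp X Y Z (g : gmap Y Z) (f : gmap X Y) : gmap X Z :=
  GMap (gcomp_equiv g f).

Section Orbit.
Variable K : {group G}.
Definition orbit_sort : finType := {A : {set G} | A \in rcosets K [set: G]}.

Lemma orbit_act_subproof (A : orbit_sort) (g : G) :
  (val A :* g)%g \in rcosets K [set: G].
Proof.
case: A => A /= /rcosetsP[x _ ->]; apply/rcosetsP; exists (x * g)%g => //.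
by rewrite rcosetM.
Qed.
Definition orbit_act_fun (A : orbit_sort) (g : G) : orbit_sort :=
  Sub (val A :* g)%g (orbit_act_subproof A g).
Lemma orbit_act1 : orbit_act_fun^~ 1%g =1 id.
Proof. by move=> A; apply: val_inj; rewrite /= rcoset1. Qed.
Lemma orbit_actM (A : orbit_sort) : act_morph orbit_act_fun A.
Proof. by move=> g h; apply: val_inj; rewrite /= rcosetM. Qed.
Definition gorbit : gset G := GSet (TotalAction orbit_act1 orbit_actM).
End Orbit.

Definition is_disjoint_union X Y Z (i : gmap X Z) (j : gmap Y Z) : Prop :=
  bijective (fun u : X + Y => match u with inl x => i x | inr y => j y end).

(*     W --p2--> Y                                                            *)
(*     |p1       |g                                                           *)
(*     X --f---> Z                                                            *)
Definition is_pullback X Y Z W (f : gmap X Z) (g : gmap Y Z)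
    (p1 : gmap W X) (p2 : gmap W Y) : Prop :=
  (forall w, f (p1 w) = g (p2 w)) /\
  (forall x y, f x = g y -> exists! w, p1 w = x /\ p2 w = y).

(*     X <--q-- A <--e-- W                                                    *)
(*     |f                |p                                                   *)
(*     Y <-------r------ Z                                                    *)
(* Here W is the pullback of f and r, with projection q \o e to X, and the    *)
(* fibre of Z over y is the set of sections s of q over the fibre of f at y,  *)
(* e being evaluation: Z is the dependent product of A along f.               *)
Definition is_exponential X Y A Z W (q : gmap A X) (f : gmap X Y)
    (r : gmap Z Y) (p : gmap W Z) (e : gmap W A) : Prop :=
  is_pullback f r (gcomp q e) p /\
  (forall (y : Y) (s : forall x, f x = y -> A),
     (forall x (fx : f x = y), q (s x fx) = x) ->
     exists! z, r z = y /\
       (forall w, p w = z -> forall fw : f (q (e w)) = y, e w = s (q (e w)) fw)).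

End GSets.

(* The case X = Y = Z = empty of mk_additive says that M vanishes on the      *)
(* empty G-set.                                                               *)
Record mackey (G : finGroupType) := Mackey {
  mk_obj :> gset G -> zmodType;
  mk_res : forall X Y, gmap X Y -> {additive mk_obj Y -> mk_obj X};
  mk_tr : forall X Y, gmap X Y -> {additive mk_obj X -> mk_obj Y};
  mk_res_ext : forall X Y (f g : gmap X Y), f =1 g -> mk_res f =1 mk_res g;
  mk_tr_ext : forall X Y (f g : gmap X Y), f =1 g -> mk_tr f =1 mk_tr g;
  mk_res_id : forall X, mk_res (gid X) =1 id;
  mk_tr_id : forall X, mk_tr (gid X) =1 id;
  mk_res_comp : forall X Y Z (g : gmap Y Z) (f : gmap X Y),
    mk_res (gcomp g f) =1 mk_res f \o mk_res g;
  mk_tr_comp : forall X Y Z (g : gmap Y Z) (f : gmap X Y),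
    mk_tr (gcomp g f) =1 mk_tr g \o mk_tr f;
  mk_base_change : forall X Y Z W (f : gmap X Z) (g : gmap Y Z)
      (p1 : gmap W X) (p2 : gmap W Y), is_pullback f g p1 p2 ->
    mk_res g \o mk_tr f =1 mk_tr p2 \o mk_res p1;
  mk_additive : forall X Y Z (i : gmap X Z) (j : gmap Y Z),
    is_disjoint_union i j -> bijective (fun m => (mk_res i m, mk_res j m))
}.

Record mackey_map (G : finGroupType) (M N : mackey G) := MackeyMap {
  mm_fun :> forall X, {additive M X -> N X};
  mm_res : forall X Y (f : gmap X Y) m,
    mm_fun X (mk_res M f m) = mk_res N f (mm_fun Y m);
  mm_tr : forall X Y (f : gmap X Y) m,
    mm_fun Y (mk_tr M f m) = mk_tr N f (mm_fun X m)
}.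

(* Frobenius reciprocity follows from these axioms, see tam_frobl.            *)
Record tambara (G : finGroupType) := Tambara {
  tam_obj :> gset G -> comPzRingType;
  tam_res : forall X Y, gmap X Y -> {rmorphism tam_obj Y -> tam_obj X};
  tam_tr : forall X Y, gmap X Y -> {additive tam_obj X -> tam_obj Y};
  tam_nm : forall X Y, gmap X Y -> tam_obj X -> tam_obj Y;
  tam_nm1 : forall X Y (f : gmap X Y), tam_nm f 1 = 1;
  tam_nmM : forall X Y (f : gmap X Y), {morph tam_nm f : a b / a * b};
  tam_res_ext : forall X Y (f g : gmap X Y), f =1 g -> tam_res f =1 tam_res g;
  tam_tr_ext : forall X Y (f g : gmap X Y), f =1 g -> tam_tr f =1 tam_tr g;
  tam_nm_ext : forall X Y (f g : gmap X Y), f =1 g -> tam_nm f =1 tam_nm g;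
  tam_res_id : forall X, tam_res (gid X) =1 id;
  tam_tr_id : forall X, tam_tr (gid X) =1 id;
  tam_nm_id : forall X, tam_nm (gid X) =1 id;
  tam_res_comp : forall X Y Z (g : gmap Y Z) (f : gmap X Y),
    tam_res (gcomp g f) =1 tam_res f \o tam_res g;
  tam_tr_comp : forall X Y Z (g : gmap Y Z) (f : gmap X Y),
    tam_tr (gcomp g f) =1 tam_tr g \o tam_tr f;
  tam_nm_comp : forall X Y Z (g : gmap Y Z) (f : gmap X Y),
    tam_nm (gcomp g f) =1 tam_nm g \o tam_nm f;
  tam_tr_base_change : forall X Y Z W (f : gmap X Z) (g : gmap Y Z)
      (p1 : gmap W X) (p2 : gmap W Y), is_pullback f g p1 p2 ->
    tam_res g \o tam_tr f =1 tam_tr p2 \o tam_res p1;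
  tam_nm_base_change : forall X Y Z W (f : gmap X Z) (g : gmap Y Z)
      (p1 : gmap W X) (p2 : gmap W Y), is_pullback f g p1 p2 ->
    tam_res g \o tam_nm f =1 tam_nm p2 \o tam_res p1;
  tam_additive : forall X Y Z (i : gmap X Z) (j : gmap Y Z),
    is_disjoint_union i j -> bijective (fun a => (tam_res i a, tam_res j a));
  tam_distr : forall X Y A Z W (q : gmap A X) (f : gmap X Y)
      (r : gmap Z Y) (p : gmap W Z) (e : gmap W A), is_exponential q f r p e ->
    tam_nm f \o tam_tr q =1 tam_tr r \o tam_nm p \o tam_res e
}.

Arguments tam_nm {G} t {X Y} f a : rename.
Arguments tam_nm_comp {G} t {X Y Z} g f a : rename.
Arguments tam_nm_base_change {G} t {X Y Z W f g p1 p2} _ a : rename.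
Arguments tam_res_comp {G} t {X Y Z} g f a : rename.
Arguments tam_tr_base_change {G} t {X Y Z W f g p1 p2} _ a : rename.
Arguments tam_distr {G} t {X Y A Z W q f r p e} _ a : rename.

Record tambara_map (G : finGroupType) (R T : tambara G) := TambaraMap {
  tm_fun :> forall X, {rmorphism R X -> T X};
  tm_res : forall X Y (f : gmap X Y) a,
    tm_fun X (tam_res R f a) = tam_res T f (tm_fun Y a);
  tm_tr : forall X Y (f : gmap X Y) a,
    tm_fun Y (tam_tr R f a) = tam_tr T f (tm_fun X a);
  tm_nm : forall X Y (f : gmap X Y) a,
    tm_fun Y (tam_nm R f a) = tam_nm T f (tm_fun X a)
}.

Section Tambara.
Variable G : finGroupType.

Definition mack (T : tambara G) : mackey G :=
  @Mackey G (fun X => T X) (fun X Y f => tam_res T f) (fun X Y f => tam_tr T f)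
    (@tam_res_ext G T) (@tam_tr_ext G T) (@tam_res_id G T) (@tam_tr_id G T)
    (@tam_res_comp G T) (@tam_tr_comp G T) (@tam_tr_base_change G T)
    (@tam_additive G T).

Definition mack_map (R T : tambara G) (f : tambara_map R T) :
    mackey_map (mack R) (mack T) :=
  @MackeyMap G (mack R) (mack T) (fun X => f X) (@tm_res G R T f) (@tm_tr G R T f).

Definition monomorphism (R T : tambara G) (phi : tambara_map R T) : Prop :=
  forall (S : tambara G) (f g : tambara_map S R),
    (forall X a, phi X (f X a) = phi X (g X a)) -> forall X a, f X a = g X a.

Definition is_tambara_iso (S T : tambara G) (f : mackey_map (mack S) (mack T)) :
    Prop :=
  exists (F : tambara_map S T) (F' : tambara_map T S),
    [/\ forall X a, F X a = f X a, forall X, cancel (F X) (F' X)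
      & forall X, cancel (F' X) (F X)].

Section SumAct.
Variables X Y : gset G.
Definition gsum_act_fun (u : X + Y) (g : G) : X + Y :=
  match u with inl x => inl (gset_act X x g) | inr y => inr (gset_act Y y g) end.
Lemma gsum_act1 : gsum_act_fun^~ 1%g =1 id.
Proof. by case=> u /=; rewrite act1. Qed.
Lemma gsum_actM u : act_morph gsum_act_fun u.
Proof. by move=> g h; case: u => u /=; rewrite actM. Qed.
Definition gsum : gset G := GSet (TotalAction gsum_act1 gsum_actM).
Definition ginl : gmap X gsum := @GMap G X gsum inl (fun _ _ => erefl).
Definition ginr : gmap Y gsum := @GMap G Y gsum inr (fun _ _ => erefl).

Definition gcase_fun (Z : gset G) (f : gmap X Z) (g : gmap Y Z) (u : gsum) : Z :=
  match u with inl x => f x | inr y => g y end.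
Lemma gcase_equiv (Z : gset G) (f : gmap X Z) (g : gmap Y Z) u a :
  gcase_fun f g (gset_act gsum u a) = gset_act Z (gcase_fun f g u) a.
Proof. by case: u => u /=; rewrite gmap_equiv. Qed.
Definition gcase (Z : gset G) (f : gmap X Z) (g : gmap Y Z) : gmap gsum Z :=
  GMap (gcase_equiv f g).

Lemma gsum_disjoint_union : is_disjoint_union ginl ginr.
Proof. by exists id; case. Qed.
End SumAct.

Lemma gempty_act1 : (fun (u : void) (_ : G) => u)^~ 1%g =1 id.
Proof. by []. Qed.
Lemma gempty_actM u : act_morph (fun (u : void) (_ : G) => u) u.
Proof. by []. Qed.
Definition gempty : gset G := GSet (TotalAction gempty_act1 gempty_actM).
Definition gfrom_empty (X : gset G) : gmap gempty X :=
  @GMap G gempty X (of_void X) (fun u _ => match u with end).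

Variable T : tambara G.

Lemma tam_empty (a b : T gempty) : a = b.
Proof.
have D : is_disjoint_union (gid gempty) (gid gempty).
  by exists (fun v : void => match v with end) => [[]|] [].
have [g _ gK] := tam_additive T D.
have [] := gK (a, b); rewrite !tam_res_id => ga gb.
exact: etrans (esym ga) gb.
Qed.

Lemma tam_sum_inj (X Y : gset G) (c d : T (gsum X Y)) :
  tam_res T (ginl X Y) c = tam_res T (ginl X Y) d ->
  tam_res T (ginr X Y) c = tam_res T (ginr X Y) d -> c = d.
Proof.
have [g gK _] := tam_additive T (gsum_disjoint_union X Y).
by move=> e1 e2; rewrite -(gK c) -(gK d) /= e1 e2.
Qed.

Lemma tam_nm_fold (X : gset G) (d : T (gsum X X)) :
  tam_nm T (gcase (gid X) (gid X)) d
    = tam_res T (ginl X X) d * tam_res T (ginr X X) d.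
Proof.
set x := tam_res _ _ d; set y := tam_res _ (ginr X X) d.
have PL : is_pullback (ginl X X) (ginl X X) (gid X) (gid X).
  by split=> // u v [->]; exists v; split=> // w [].
have PR : is_pullback (ginr X X) (ginr X X) (gid X) (gid X).
  by split=> // u v [->]; exists v; split=> // w [].
have PLR : is_pullback (ginl X X) (ginr X X) (gfrom_empty X) (gfrom_empty X).
  by split=> // -[].
have PRL : is_pullback (ginr X X) (ginl X X) (gfrom_empty X) (gfrom_empty X).
  by split=> // -[].
have /= eLL z := tam_nm_base_change T PL z.
have /= eRR z := tam_nm_base_change T PR z.
have /= eLR z := tam_nm_base_change T PLR z.
have /= eRL z := tam_nm_base_change T PRL z.
have dE : d = tam_nm T (ginl X X) x * tam_nm T (ginr X X) y.
  apply: tam_sum_inj; rewrite rmorphM.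
    rewrite eLL eRL tam_res_id tam_nm_id.
    by rewrite [tam_res T _ y](tam_empty _ 1) tam_nm1 mulr1.
  rewrite eRR eLR tam_res_id tam_nm_id.
  by rewrite [tam_res T _ x](tam_empty _ 1) tam_nm1 mul1r.
rewrite {1}dE tam_nmM.
have /= <- := tam_nm_comp T (gcase (gid X) (gid X)) (ginl X X) x.
have /= <- := tam_nm_comp T (gcase (gid X) (gid X)) (ginr X X) y.
by rewrite !(@tam_nm_ext _ T _ _ _ (gid X)) // !tam_nm_id.
Qed.

Lemma tam_frobl (A X : gset G) (f : gmap A X) (a : T A) (b : T X) :
  tam_tr T f a * b = tam_tr T f (a * tam_res T f b).
Proof.
have [g _ gK] := tam_additive T (gsum_disjoint_union A X).
pose c := g (a, b); have [ca cb] := gK (a, b); rewrite -/c in ca cb.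
pose q : gmap (gsum A X) (gsum X X) :=
  gcase (gcomp (ginl X X) f) (gcomp (ginr X X) (gid X)).
pose e : gmap (gsum A A) (gsum A X) :=
  gcase (ginl A X) (gcomp (ginr A X) f).
have PL : is_pullback q (ginl X X) (ginl A X) f.
  split=> // -[u|u] v //= [<-]; exists u; split=> // w [[->]] //.
have PR : is_pullback q (ginr X X) (ginr A X) (gid X).
  split=> // -[u|u] v //= [<-]; exists u; split=> // w [[->]] //.
have E : is_exponential q (gcase (gid X) (gid X)) f (gcase (gid A) (gid A)) e.
  split; first split.
  - by case.
  - case=> [u|u] v /= uv; [exists (inl v) | exists (inr v)]; rewrite uv;
      by split=> // -[w|w] [] //= _ ->.
  move=> y s sq.
  have := sq (inl y) erefl; case Es: (s (inl y) erefl) => [z|z] //= [zy].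
  exists z; split.
    split=> // -[w|w] /= wz fw.
      move: fw; rewrite wz zy => fw.
      by rewrite (eq_irrelevance fw erefl) Es.
    move: fw; rewrite wz zy => fw.
    have := sq (inr y) fw; case: (s (inr y) fw) => //= v [->] //.
  move=> z' [z'y /(_ (inl z') erefl z'y)] /=.
  by case: y / z'y s sq Es {zy} => s sq Es; rewrite Es; case.
have /= := tam_distr T E c.
have /= dl := tam_tr_base_change T PL c.
have /= dr := tam_tr_base_change T PR c.
have /= el := tam_res_comp T e (ginl A A) c.
have /= er := tam_res_comp T e (ginr A A) c.
rewrite !tam_nm_fold dl dr ca cb tam_tr_id -el -er.
rewrite (@tam_res_ext _ T _ _ _ (ginl A X)) // ca.
rewrite (@tam_res_ext _ T _ _ (gcomp e _) (gcomp (ginr A X) f)) //.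
by rewrite tam_res_comp /= cb.
Qed.

End Tambara.

(* Dress pairings. They correspond to the natural maps                        *)
(* M(X) (x) N(Y) -> P(X x Y) of the Day convolution: restrict the latter along *)
(* the diagonal of X, and extend the former by res_fst m, res_snd n.          *)
Record pairing (G : finGroupType) (M N P : mackey G) := Pairing {
  pr_fun :> forall X, M X -> N X -> P X;
  pr_addl : forall X (n : N X), {morph (@pr_fun X)^~ n : m m' / m + m'};
  pr_addr : forall X (m : M X), {morph @pr_fun X m : n n' / n + n'};
  pr_res : forall X Y (f : gmap X Y) m n,
    mk_res P f (pr_fun m n) = pr_fun (mk_res M f m) (mk_res N f n);
  pr_frobl : forall X Y (f : gmap X Y) m n,
    pr_fun (mk_tr M f m) n = mk_tr P f (pr_fun m (mk_res N f n));
  pr_frobr : forall X Y (f : gmap X Y) m n,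
    pr_fun m (mk_tr N f n) = mk_tr P f (pr_fun (mk_res M f m) n)
}.

Record box_product (G : finGroupType) (M N : mackey G) := BoxProduct {
  box_obj :> mackey G;
  tens : pairing M N box_obj;
  box_lift : forall P, pairing M N P -> mackey_map box_obj P;
  box_liftE : forall P (b : pairing M N P) X m n,
    box_lift b X (tens X m n) = b X m n;
  box_uniq : forall P (f g : mackey_map box_obj P),
    (forall X m n, f X (tens X m n) = g X (tens X m n)) ->
    forall X u, f X u = g X u
}.

Record coequalizer (G : finGroupType) (M N : mackey G) (a b : mackey_map M N)
    (Q : mackey G) := Coequalizer {
  coeq_proj : mackey_map N Q;
  coeq_eq : forall X m, coeq_proj X (a X m) = coeq_proj X (b X m);
  coeq_lift : forall P (f : mackey_map N P),
    (forall X m, f X (a X m) = f X (b X m)) -> mackey_map Q P;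
  coeq_liftE : forall P f fab X n, @coeq_lift P f fab X (coeq_proj X n) = f X n;
  coeq_uniq : forall P (f g : mackey_map Q P),
    (forall X n, f X (coeq_proj X n) = g X (coeq_proj X n)) ->
    forall X q, f X q = g X q
}.

Section Box.
#[local] Obligation Tactic := idtac.
Variable G : finGroupType.
Implicit Types (M N P : mackey G) (T : tambara G).

Program Definition mm_id M : mackey_map M M :=
  @MackeyMap G M M (fun X => idfun) _ _.
Next Obligation. by []. Qed.
Next Obligation. by []. Qed.

Program Definition mm_comp M N P (g : mackey_map N P) (f : mackey_map M N) :
    mackey_map M P :=
  @MackeyMap G M P (fun X => g X \o f X) _ _.
Next Obligation. by move=> * /=; rewrite !mm_res. Qed.
Next Obligation. by move=> * /=; rewrite !mm_tr. Qed.

Program Definition pr_comp M M' N N' P (f : mackey_map M M')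
    (g : mackey_map N N') (b : pairing M' N' P) : pairing M N P :=
  @Pairing G M N P (fun X m n => b X (f X m) (g X n)) _ _ _ _ _.
Next Obligation. by move=> * ? ? /=; rewrite raddfD pr_addl. Qed.
Next Obligation. by move=> * ? ? /=; rewrite raddfD pr_addr. Qed.
Next Obligation. by move=> * /=; rewrite pr_res !mm_res. Qed.
Next Obligation. by move=> * /=; rewrite mm_tr pr_frobl !mm_res. Qed.
Next Obligation. by move=> * /=; rewrite mm_tr pr_frobr !mm_res. Qed.

Program Definition pr_post M N P P' (h : mackey_map P P') (b : pairing M N P) :
    pairing M N P' :=
  @Pairing G M N P' (fun X m n => h X (b X m n)) _ _ _ _ _.
Next Obligation. by move=> * ? ? /=; rewrite pr_addl raddfD. Qed.
Next Obligation. by move=> * ? ? /=; rewrite pr_addr raddfD. Qed.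
Next Obligation. by move=> * /=; rewrite -mm_res pr_res. Qed.
Next Obligation. by move=> * /=; rewrite pr_frobl mm_tr. Qed.
Next Obligation. by move=> * /=; rewrite pr_frobr mm_tr. Qed.

Definition box_map M M' N N' (B : box_product M N) (B' : box_product M' N')
    (f : mackey_map M M') (g : mackey_map N N') : mackey_map B B' :=
  box_lift B (pr_comp f g (tens B')).

Program Definition mul_pairing T : pairing (mack T) (mack T) (mack T) :=
  @Pairing G (mack T) (mack T) (mack T) (fun X a b => (a : T X) * b) _ _ _ _ _.
Next Obligation. by move=> T X n a b; rewrite mulrDl. Qed.
Next Obligation. by move=> T X n a b; rewrite mulrDr. Qed.
Next Obligation. by move=> T X Y f a b /=; rewrite rmorphM. Qed.
Next Obligation. by move=> T X Y f a b /=; rewrite tam_frobl. Qed.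
Next Obligation.
move=> T X Y f a b /=; rewrite [LHS]mulrC tam_frobl.
by rewrite [in LHS](mulrC b).
Qed.

Section Prod.
Variables X Y : gset G.
Definition gprod_act_fun (u : X * Y) (g : G) : X * Y :=
  (gset_act X u.1 g, gset_act Y u.2 g).
Lemma gprod_act1 : gprod_act_fun^~ 1%g =1 id.
Proof. by case=> u v; rewrite /gprod_act_fun /= !act1. Qed.
Lemma gprod_actM u : act_morph gprod_act_fun u.
Proof. by move=> g h; rewrite /gprod_act_fun /= !actM. Qed.
Definition gprod : gset G := GSet (TotalAction gprod_act1 gprod_actM).
Definition gfst : gmap gprod X := @GMap G gprod X fst (fun _ _ => erefl).
Definition gsnd : gmap gprod Y := @GMap G gprod Y snd (fun _ _ => erefl).
End Prod.

Lemma gdiag_equiv (X : gset G) (x : X) (g : G) :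
  (gset_act X x g, gset_act X x g) = gset_act (gprod X X) (x, x) g.
Proof. by []. Qed.
Definition gdiag (X : gset G) : gmap X (gprod X X) :=
  @GMap G X (gprod X X) (fun x => (x, x)) (@gdiag_equiv X).

Lemma gmulr_equiv (X X' Y : gset G) (f : gmap X X') (u : gprod X Y) (g : G) :
  (f (gset_act (gprod X Y) u g).1, (gset_act (gprod X Y) u g).2)
    = gset_act (gprod X' Y) (f u.1, u.2) g.
Proof. by rewrite /= /gprod_act_fun /= gmap_equiv. Qed.
Definition gmulr (X X' Y : gset G) (f : gmap X X') : gmap (gprod X Y) (gprod X' Y) :=
  @GMap G (gprod X Y) (gprod X' Y) (fun u => (f u.1, u.2)) (@gmulr_equiv X X' Y f).

Lemma gmulr_pullback (X Y Z W V : gset G) (f : gmap X Z) (g : gmap Y Z)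
    (p1 : gmap W X) (p2 : gmap W Y) :
  is_pullback f g p1 p2 ->
  is_pullback (gmulr V f) (gmulr V g) (gmulr V p1) (gmulr V p2).
Proof.
case=> pC pU; split=> [[w v]|[x v] [y v'] [fg <-]] /=; first by rewrite pC.
have [w [[wx wy] wU]] := pU _ _ fg; exists (w, v); split=> /= [|[w' v2]].
  by rewrite wx wy.
by case=> /= -[w'x ->] [w'y]; rewrite (wU w').
Qed.

Lemma gmulr_disjoint_union (X Y Z V : gset G) (i : gmap X Z) (j : gmap Y Z) :
  is_disjoint_union i j -> is_disjoint_union (gmulr V i) (gmulr V j).
Proof.
case=> h hK Kh.
exists (fun u => match h u.1 with inl x => inl (x, u.2) | inr y => inr (y, u.2) end).
  by case=> [[x v]|[y v]] /=; [rewrite (hK (inl x)) | rewrite (hK (inr y))].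
by case=> z v /=; have := Kh z; case: (h z) => /= t ->.
Qed.

Definition shift P (V : gset G) : mackey G.
Proof.
refine (@Mackey G (fun X => P (gprod X V)) (fun X Y f => mk_res P (gmulr V f))
  (fun X Y f => mk_tr P (gmulr V f)) _ _ _ _ _ _ _ _).
- by move=> X Y f g fg; apply: mk_res_ext => -[x v] /=; rewrite fg.
- by move=> X Y f g fg; apply: mk_tr_ext => -[x v] /=; rewrite fg.
- by move=> X m; rewrite -[RHS](mk_res_id m); apply: mk_res_ext => -[].
- by move=> X m; rewrite -[RHS](mk_tr_id m); apply: mk_tr_ext => -[].
- move=> X Y Z g f m /=.
  have /= <- := mk_res_comp (gmulr V g) (gmulr V f) m.
  by apply: mk_res_ext.
- move=> X Y Z g f m /=.
  have /= <- := mk_tr_comp (gmulr V g) (gmulr V f) m.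
  by apply: mk_tr_ext.
- move=> X Y Z W f g p1 p2 pb.
  exact: (mk_base_change (gmulr_pullback V pb)).
- move=> X Y Z i j ij.
  exact: (mk_additive P (gmulr_disjoint_union V ij)).
Defined.

Lemma gfst_pullback (X Y V : gset G) (f : gmap X Y) :
  is_pullback f (gfst Y V) (gfst X V) (gmulr V f).
Proof.
split=> // x [y v] /= fx; exists (x, v); split=> /= [|[x' v']]; first by rewrite fx.
by case=> /= -> [_ ->].
Qed.

Section Slice.
Variables (M N N' P : mackey G) (b : pairing M N N') (F : mackey_map N' P).
Variables (V : gset G) (n : N V).

Definition slice_fun (X : gset G) (m : M X) : shift P V X :=
  F _ (b (gprod X V) (mk_res M (gfst X V) m) (mk_res N (gsnd X V) n)).

Lemma slice_additive X : zmod_morphism (@slice_fun X).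
Proof.
have bB Z (k : N Z) : zmod_morphism (fun m => b Z m k).
  move=> m m'; apply: (addIr (b Z m' k)); rewrite subrK.
  by have /= <- := pr_addl b k; rewrite subrK.
by move=> m m'; rewrite /slice_fun raddfB bB raddfB.
Qed.
HB.instance Definition _ X :=
  GRing.isZmodMorphism.Build (M X) (shift P V X) (@slice_fun X) (@slice_additive X).

Lemma slice_res X Y (f : gmap X Y) m :
  slice_fun (mk_res M f m) = mk_res (shift P V) f (slice_fun m).
Proof.
rewrite /slice_fun /= -mm_res pr_res; congr (F _ (b _ _ _)).
  have /= <- := mk_res_comp f (gfst X V) m.
  have /= <- := mk_res_comp (gfst Y V) (gmulr V f) m.
  exact: mk_res_ext.
have /= <- := mk_res_comp (gsnd Y V) (gmulr V f) n.
exact: mk_res_ext.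
Qed.

Lemma slice_tr X Y (f : gmap X Y) m :
  slice_fun (mk_tr M f m) = mk_tr (shift P V) f (slice_fun m).
Proof.
rewrite /slice_fun /= -mm_tr.
have /= -> := mk_base_change (gfst_pullback V f) m.
rewrite pr_frobl; congr (F _ (mk_tr _ _ (b _ _ _))).
have /= <- := mk_res_comp (gsnd Y V) (gmulr V f) n.
exact: mk_res_ext.
Qed.

Definition slice : mackey_map M (shift P V) :=
  @MackeyMap G M (shift P V) (fun X => @slice_fun X) slice_res slice_tr.
End Slice.

Lemma slice_diag (M N N' P : mackey G) (b : pairing M N N')
    (F : mackey_map N' P) V (m : M V) (n : N V) :
  F V (b V m n) = mk_res P (gdiag V) (slice b F n V m).
Proof.
rewrite /= /slice_fun -mm_res pr_res.
have /= <- := mk_res_comp (gfst V V) (gdiag V) m.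
have /= <- := mk_res_comp (gsnd V V) (gdiag V) n.
rewrite -{1}(mk_res_id m) -{1}(mk_res_id n).
by congr (F _ (b _ _ _)); apply: mk_res_ext.
Qed.

Lemma box3_uniq (L M N P : mackey G) (B : box_product L M) (C : box_product B N)
    (f g : mackey_map C P) :
  (forall X l m n, f X (tens C X (tens B X l m) n)
                 = g X (tens C X (tens B X l m) n)) ->
  forall X u, f X u = g X u.
Proof.
move=> fg; apply: box_uniq => V u n; rewrite !slice_diag; congr (mk_res _ _ _).
apply: (@box_uniq _ _ _ B _ (slice (tens C) f n) (slice (tens C) g n)) => X l m.
by rewrite /= /slice_fun !(pr_res (tens B)) fg.
Qed.

End Box.

(* A model of T []_R T: the coequalizer of the two R-actions                  *)
(* T [] R [] T => T [] T, with its Tambara structure.                         *)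
(* By box3_uniq, relbox_actrE and relbox_actlE determine the two actions of R *)
(* on T [] R [] T. The Tambara structure on T []_R T is determined by its     *)
(* values on elementary tensors, whose transfers generate each level.         *)
Record relative_box (G : finGroupType) (R T : tambara G) (phi : tambara_map R T) :=
  RelativeBox {
  relbox_obj :> tambara G;
  relbox_TT : box_product (mack T) (mack T);
  relbox_TR : box_product (mack T) (mack R);
  relbox_TRT : box_product relbox_TR (mack T);
  relbox_actr : mackey_map relbox_TRT relbox_TT;
  relbox_actl : mackey_map relbox_TRT relbox_TT;
  relbox_actrE : forall X (t : T X) (r : R X) (t' : T X),
    relbox_actr X (tens relbox_TRT X (tens relbox_TR X t r) t')
      = tens relbox_TT X (t * phi X r) t';
  relbox_actlE : forall X (t : T X) (r : R X) (t' : T X),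
    relbox_actl X (tens relbox_TRT X (tens relbox_TR X t r) t')
      = tens relbox_TT X t (phi X r * t');
  relbox_coeq : coequalizer relbox_actr relbox_actl (mack relbox_obj);
  relbox_tens := fun X (t t' : T X) =>
    coeq_proj relbox_coeq X (tens relbox_TT X t t') : relbox_obj X;
  relbox_one : forall X, relbox_tens (1 : T X) 1 = 1;
  relbox_mul : forall X (a a' b b' : T X),
    relbox_tens a a' * relbox_tens b b' = relbox_tens (a * b) (a' * b');
  relbox_nm : forall X Y (f : gmap X Y) (t t' : T X),
    tam_nm relbox_obj f (relbox_tens t t')
      = relbox_tens (tam_nm T f t) (tam_nm T f t')
}.

Record algebra_action (G H : finGroupType) (R T : tambara G)
    (phi : tambara_map R T) := AlgebraAction {
  alg_act :> H -> tambara_map T T;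
  alg_act1 : forall X t, alg_act 1%g X t = t;
  alg_actM : forall h k X t, alg_act (h * k)%g X t = alg_act h X (alg_act k X t);
  alg_act_phi : forall h X r, alg_act h X (phi X r) = phi X r
}.

Section RelativeBox.
Variables (G : finGroupType) (R T : tambara G) (phi : tambara_map R T).
Variable B : relative_box phi.

Definition rtens (X : gset G) (t t' : T X) : B X :=
  coeq_proj (relbox_coeq B) X (tens (relbox_TT B) X t t').

Lemma rtens_balanced X (t : T X) (r : R X) (t' : T X) :
  rtens (t * phi X r) t' = rtens t (phi X r * t').
Proof. by rewrite /rtens -relbox_actrE -relbox_actlE coeq_eq. Qed.

Lemma rtensM X (a a' b b' : T X) :
  rtens a a' * rtens b b' = rtens (a * b) (a' * b').
Proof. exact: relbox_mul. Qed.

Lemma rtens11 X : rtens (1 : T X) 1 = 1.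
Proof. exact: relbox_one. Qed.

Lemma rtensDl X (t' : T X) : {morph (@rtens X)^~ t' : a b / a + b}.
Proof. by move=> a b; rewrite /rtens pr_addl raddfD. Qed.

Lemma rtensDr X (t : T X) : {morph @rtens X t : a b / a + b}.
Proof. by move=> a b; rewrite /rtens pr_addr raddfD. Qed.

Lemma rtens_res X Y (f : gmap X Y) (t t' : T Y) :
  tam_res B f (rtens t t') = rtens (tam_res T f t) (tam_res T f t').
Proof.
rewrite /rtens; have /= <- := mm_res (coeq_proj (relbox_coeq B)) f.
by rewrite pr_res.
Qed.

Lemma relbox_mu_subproof X u :
  box_lift (relbox_TT B) (mul_pairing T) X (relbox_actr B X u)
  = box_lift (relbox_TT B) (mul_pairing T) X (relbox_actl B X u).
Proof.
apply: (box3_uniq (f := mm_comp (box_lift _ (mul_pairing T)) (relbox_actr B))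
                  (g := mm_comp (box_lift _ (mul_pairing T)) (relbox_actl B))).
move=> Y t r t'.
by rewrite /= relbox_actrE relbox_actlE !box_liftE /= mulrA.
Qed.
Definition relbox_mu : mackey_map (mack B) (mack T) :=
  coeq_lift (relbox_coeq B) relbox_mu_subproof.

Lemma relbox_mu_rtens X (t t' : T X) : relbox_mu X (rtens t t') = t * t'.
Proof.
have /= -> := coeq_liftE (relbox_coeq B) relbox_mu_subproof
  (tens (relbox_TT B) X t t').
by rewrite box_liftE.
Qed.

Section IdBox.
Variable f : tambara_map T T.
Hypothesis f_phi : forall X r, f X (phi X r) = phi X r.
Definition id_box : mackey_map (relbox_TT B) (mack B) :=
  mm_comp (coeq_proj (relbox_coeq B))
    (box_map (relbox_TT B) (relbox_TT B) (mm_id (mack T)) (mack_map f)).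
Lemma relbox_id_box_subproof X u :
  id_box X (relbox_actr B X u) = id_box X (relbox_actl B X u).
Proof.
apply: (box3_uniq (f := mm_comp id_box (relbox_actr B))
                  (g := mm_comp id_box (relbox_actl B))).
move=> Y t r t'.
rewrite /= relbox_actrE relbox_actlE /box_map !box_liftE /=.
by rewrite rmorphM f_phi; apply: rtens_balanced.
Qed.
Definition relbox_id_box : mackey_map (mack B) (mack B) :=
  coeq_lift (relbox_coeq B) relbox_id_box_subproof.

Lemma relbox_id_box_rtens X (t t' : T X) :
  relbox_id_box X (rtens t t') = rtens t (f X t').
Proof.
have /= -> := coeq_liftE (relbox_coeq B) relbox_id_box_subproof
  (tens (relbox_TT B) X t t').
by rewrite /box_map box_liftE.
Qed.
End IdBox.
End RelativeBox.

Section ProdTambara.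
Variables (G : finGroupType) (H : finType) (T : tambara G).

Section Map.
Variables (U V : comPzRingType) (f : {additive U -> V}).
Definition ffun_map (g : U -> V) (a : {ffun H -> U}) : {ffun H -> V} :=
  [ffun h => g (a h)].
Lemma ffun_map_additive : zmod_morphism (ffun_map f).
Proof. by move=> a b; apply/ffunP=> h; rewrite !ffunE raddfB. Qed.
End Map.
HB.instance Definition _ (U V : comPzRingType) (f : {additive U -> V}) :=
  GRing.isZmodMorphism.Build {ffun H -> U} {ffun H -> V} (ffun_map f)
    (ffun_map_additive f).
Lemma ffun_map_monoid (U V : comPzRingType) (f : {rmorphism U -> V}) :
  monoid_morphism (ffun_map f).
Proof.
split=> [|a b]; apply/ffunP=> h; rewrite !ffunE; first exact: rmorph1.
exact: rmorphM.
Qed.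
HB.instance Definition _ (U V : comPzRingType) (f : {rmorphism U -> V}) :=
  GRing.isMonoidMorphism.Build {ffun H -> U} {ffun H -> V} (ffun_map f)
    (ffun_map_monoid f).

Definition prod_tambara : tambara G.
Proof.
refine (@Tambara G (fun X => {ffun H -> T X} : comPzRingType)
  (fun X Y f => ffun_map (tam_res T f)) (fun X Y f => ffun_map (tam_tr T f))
  (fun X Y f => ffun_map (tam_nm T f))
  _ _ _ _ _ _ _ _ _ _ _ _ _ _ _).
- by move=> X Y f; apply/ffunP=> h; rewrite !ffunE tam_nm1.
- by move=> X Y f a b; apply/ffunP=> h; rewrite !ffunE tam_nmM.
- by move=> X Y f g fg a; apply/ffunP=> h; rewrite !ffunE (tam_res_ext fg).
- by move=> X Y f g fg a; apply/ffunP=> h; rewrite !ffunE (tam_tr_ext fg).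
- by move=> X Y f g fg a; apply/ffunP=> h; rewrite !ffunE (tam_nm_ext fg).
- by move=> X a; apply/ffunP=> h; rewrite !ffunE tam_res_id.
- by move=> X a; apply/ffunP=> h; rewrite !ffunE tam_tr_id.
- by move=> X a; apply/ffunP=> h; rewrite !ffunE tam_nm_id.
- by move=> X Y Z g f a; apply/ffunP=> h; rewrite !ffunE tam_res_comp.
- by move=> X Y Z g f a; apply/ffunP=> h; rewrite !ffunE tam_tr_comp.
- by move=> X Y Z g f a; apply/ffunP=> h; rewrite !ffunE tam_nm_comp.
- move=> X Y Z W f g p1 p2 pb a; apply/ffunP=> h; rewrite !ffunE.
  exact: tam_tr_base_change.
- move=> X Y Z W f g p1 p2 pb a; apply/ffunP=> h; rewrite !ffunE.
  exact: tam_nm_base_change.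
- move=> X Y Z i j /(tam_additive T)[k kK Kk].
  exists (fun ab : {ffun H -> T X} * {ffun H -> T Y} =>
            [ffun h => k (ab.1 h, ab.2 h)]) => [a|[a b]] /=.
    by apply/ffunP=> h; rewrite !ffunE; apply: kK.
  by congr (_, _); apply/ffunP=> h; rewrite !ffunE;
    have [] := Kk (a h, b h).
- move=> X Y A Z W q f r p e E a; apply/ffunP=> h; rewrite !ffunE.
  exact: (tam_distr T E).
Defined.
End ProdTambara.

Section Galois.
Variables (G H : finGroupType) (R T : tambara G) (phi : tambara_map R T).
Variables (act : algebra_action H phi) (B : relative_box phi).

Definition fixed_points (X : gset G) : Type :=
  {t : T X | [forall h, act h X t == t]}.

Lemma phi_fixed_subproof X (r : R X) : [forall h, act h X (phi X r) == phi X r].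
Proof. by apply/forallP=> h; rewrite alg_act_phi. Qed.
Definition phi_fixed X (r : R X) : fixed_points X :=
  Sub (phi X r) (phi_fixed_subproof r).

Definition galois_chi_fun X (u : B X) : {ffun H -> T X} :=
  [ffun h => relbox_mu B X (relbox_id_box B (alg_act_phi act h) X u)].
Lemma galois_chi_additive X : zmod_morphism (@galois_chi_fun X).
Proof. by move=> u v; apply/ffunP=> h; rewrite !ffunE !raddfB. Qed.
HB.instance Definition _ X :=
  GRing.isZmodMorphism.Build (B X) {ffun H -> T X} (@galois_chi_fun X)
    (@galois_chi_additive X).

Lemma galois_chi_res X Y (f : gmap X Y) (u : mack B Y) :
  galois_chi_fun (mk_res (mack B) f u)
    = mk_res (mack (prod_tambara H T)) f (galois_chi_fun u).
Proof. by apply/ffunP=> h; rewrite !ffunE !mm_res. Qed.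
Lemma galois_chi_tr X Y (f : gmap X Y) (u : mack B X) :
  galois_chi_fun (mk_tr (mack B) f u)
    = mk_tr (mack (prod_tambara H T)) f (galois_chi_fun u).
Proof. by apply/ffunP=> h; rewrite !ffunE !mm_tr. Qed.

Definition galois_chi : mackey_map (mack B) (mack (prod_tambara H T)) :=
  @MackeyMap G (mack B) (mack (prod_tambara H T)) (fun X => @galois_chi_fun X)
    galois_chi_res galois_chi_tr.

Lemma galois_chi_rtens X (x y : T X) h :
  galois_chi X (rtens B x y) h = x * act h X y.
Proof. by rewrite ffunE relbox_id_box_rtens relbox_mu_rtens. Qed.

(* phi_fixed is the corestriction of a ring map to a subring, so bijectivity  *)
(* makes it an isomorphism of rings.                                          *)
Definition galois_extension : Prop :=
  [/\ monomorphism phi,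
      forall K : {group G}, bijective (@phi_fixed (gorbit K))
    & is_tambara_iso galois_chi].
End Galois.

(* Over R: the two actions of R through phi agree.                            *)
Record bimodule (G : finGroupType) (R T : tambara G) (phi : tambara_map R T) :=
  Bimodule {
  bim_obj :> mackey G;
  bim_l : pairing (mack T) bim_obj bim_obj;
  bim_r : pairing bim_obj (mack T) bim_obj;
  bim_l1 : forall X m, bim_l X (1 : T X) m = m;
  bim_r1 : forall X m, bim_r X m (1 : T X) = m;
  bim_lA : forall X (a b : T X) m, bim_l X (a * b) m = bim_l X a (bim_l X b m);
  bim_rA : forall X m (a b : T X), bim_r X m (a * b) = bim_r X (bim_r X m a) b;
  bim_lrA : forall X (a : T X) m (b : T X),
    bim_r X (bim_l X a m) b = bim_l X a (bim_r X m b);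
  bim_over : forall X (r : R X) m, bim_l X (phi X r) m = bim_r X m (phi X r)
}.

Definition is_bimodule_map (G : finGroupType) (R T : tambara G)
    (phi : tambara_map R T) (M N : bimodule phi) (s : mackey_map M N) : Prop :=
  (forall X (a : T X) m, s X (bim_l M X a m) = bim_l N X a (s X m)) /\
  (forall X m (a : T X), s X (bim_r M X m a) = bim_r N X (s X m) a).

Section Separable.
Variables (G : finGroupType) (R T : tambara G) (phi : tambara_map R T).
Variable B : relative_box phi.

Definition regular_bimodule : bimodule phi.
Proof.
refine (@Bimodule G R T phi (mack T) (mul_pairing T) (mul_pairing T)
  _ _ _ _ _ _) => X *.
- exact: mul1r.
- exact: mulr1.
- exact: esym (mulrA _ _ _).
- exact: mulrA.
- exact: esym (mulrA _ _ _).
- exact: mulrC.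
Defined.

Definition rtens_inl_fun X (a : T X) : B X := rtens B a 1.
Lemma rtens_inl_additive X : zmod_morphism (@rtens_inl_fun X).
Proof.
move=> a b; rewrite /rtens_inl_fun; apply: (addIr (rtens B b 1)); rewrite subrK.
by have /= <- := rtensDl B (1 : T X) (a - b) b; rewrite subrK.
Qed.
HB.instance Definition _ X :=
  GRing.isZmodMorphism.Build (T X) (B X) (@rtens_inl_fun X)
    (@rtens_inl_additive X).

Definition rtens_inr_fun X (a : T X) : B X := rtens B 1 a.
Lemma rtens_inr_additive X : zmod_morphism (@rtens_inr_fun X).
Proof.
move=> a b; rewrite /rtens_inr_fun; apply: (addIr (rtens B 1 b)); rewrite subrK.
by have /= <- := rtensDr B (1 : T X) (a - b) b; rewrite subrK.
Qed.
HB.instance Definition _ X :=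
  GRing.isZmodMorphism.Build (T X) (B X) (@rtens_inr_fun X)
    (@rtens_inr_additive X).

Lemma rtens_frobl X Y (f : gmap X Y) (a : T X) (b : T Y) :
  rtens B (tam_tr T f a) b = tam_tr B f (rtens B a (tam_res T f b)).
Proof.
rewrite /rtens; have /= -> := pr_frobl (tens (relbox_TT B)) f a b.
exact: (mm_tr (coeq_proj (relbox_coeq B))).
Qed.

Lemma rtens_frobr X Y (f : gmap X Y) (a : T Y) (b : T X) :
  rtens B a (tam_tr T f b) = tam_tr B f (rtens B (tam_res T f a) b).
Proof.
rewrite /rtens; have /= -> := pr_frobr (tens (relbox_TT B)) f a b.
exact: (mm_tr (coeq_proj (relbox_coeq B))).
Qed.

Definition rtens_inl : mackey_map (mack T) (mack B).
Proof.
refine (@MackeyMap G (mack T) (mack B)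
  (fun X => @rtens_inl_fun X) _ _).
- by move=> X Y f a; rewrite /= /rtens_inl_fun /rtens_inr_fun rtens_res rmorph1.
- by move=> X Y f a; rewrite /= /rtens_inl_fun rtens_frobl rmorph1.
Defined.

Definition rtens_inr : mackey_map (mack T) (mack B).
Proof.
refine (@MackeyMap G (mack T) (mack B)
  (fun X => @rtens_inr_fun X) _ _).
- by move=> X Y f a; rewrite /= /rtens_inl_fun /rtens_inr_fun rtens_res rmorph1.
- by move=> X Y f a; rewrite /= /rtens_inr_fun rtens_frobr rmorph1.
Defined.

(* The actions are a (x [] y) = ax [] y and (x [] y) a = x [] ya, see         *)
(* relbox_bim_l_rtens and relbox_bim_r_rtens.                                 *)
Definition relbox_bimodule : bimodule phi.
Proof.
refine (@Bimodule G R T phi (mack B)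
  (pr_comp rtens_inl (mm_id (mack B)) (mul_pairing B))
  (pr_comp (mm_id (mack B)) rtens_inr (mul_pairing B)) _ _ _ _ _ _) => X /=; rewrite ?/rtens_inl_fun ?/rtens_inr_fun.
- by move=> m; rewrite rtens11 mul1r.
- by move=> m; rewrite rtens11 mulr1.
- by move=> a b m; rewrite mulrA rtensM mulr1.
- by move=> m a b; rewrite -mulrA rtensM mulr1.
- by move=> a m b; rewrite mulrA.
- by move=> r m; rewrite -[phi X r]mul1r rtens_balanced mulr1 mul1r mulrC.
Defined.

Lemma relbox_bim_l_rtens X (a x y : T X) :
  bim_l relbox_bimodule X a (rtens B x y) = rtens B (a * x) y.
Proof. by rewrite /= /rtens_inl_fun /rtens_inr_fun rtensM mul1r. Qed.

Lemma relbox_bim_r_rtens X (a x y : T X) :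
  bim_r relbox_bimodule X (rtens B x y) a = rtens B x (y * a).
Proof. by rewrite /= /rtens_inl_fun /rtens_inr_fun rtensM mulr1. Qed.

Definition separable : Prop :=
  exists s : mackey_map (mack T) (mack B),
    is_bimodule_map (M := regular_bimodule) (N := relbox_bimodule) s /\
    forall X t, relbox_mu B X (s X t) = t.
End Separable.

(* Main.v *)
Require Import Defs.
From HB Require Import structures.
From mathcomp Require Import all_boot all_order all_fingroup all_algebra.

(** For a Galois extension, [T []_R T] is identified by chi with the product of
    copies of [T] indexed by [H]. Under this identification
    - mu is the projection to the component at the identity of [H]
      ([galois_chi_at1]), because the identity acts trivially;
    - the left action of [T] is multiplication by [a] in every component, and the
      right action is multiplication by [h a] in the component at [h]
      ([galois_chi_rtens]).
    So the inclusion of the component at the identity, extended by zero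
    ([prod_incl1]), is a section of mu. It commutes with transfers and
    restrictions because the product is formed levelwise, and it respects both
    actions because the right action on the component at the identity is by
    [1 a = a]. Composing it with the inverse of chi gives the section; the
    separability idempotent is the preimage of the indicator of the identity. *)

Set Implicit Arguments.
Unset Strict Implicit.
Unset Printing Implicit Defensive.

Import GRing.Theory.
Local Open Scope ring_scope.

Section MapsOutOfRelativeBox.
Variables (G : finGroupType) (R T : tambara G) (phi : tambara_map R T).
Variable B : relative_box phi.

(** The box product and the coequalizer are known only through their universal
    properties, so this is the tool for comparing maps out of [T []_R T]. *)
Lemma rtens_uniq (P : mackey G) (f g : mackey_map (mack B) P) :
  (forall X (t t' : T X), f X (rtens B t t') = g X (rtens B t t')) ->
  forall X u, f X u = g X u.
Proof.
move=> fg; apply: (@coeq_uniq _ _ _ _ _ _ (relbox_coeq B)).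
exact: (@box_uniq _ _ _ (relbox_TT B) _
  (mm_comp f (coeq_proj (relbox_coeq B))) (mm_comp g (coeq_proj (relbox_coeq B)))).
Qed.

Lemma galois_chi_at1 (H : finGroupType) (act : algebra_action H phi)
    (X : gset G) (u : B X) :
  galois_chi act B X u 1%g = relbox_mu B X u.
Proof.
rewrite ffunE.
apply: (rtens_uniq
  (f := mm_comp (relbox_mu B) (relbox_id_box B (alg_act_phi act 1%g)))).
by move=> Y t t'; rewrite /= relbox_id_box_rtens !relbox_mu_rtens alg_act1.
Qed.

End MapsOutOfRelativeBox.

Section ComponentAtIdentity.
Variables (G H : finGroupType) (T : tambara G).

Definition prod_incl1_fun (X : gset G) (t : T X) : {ffun H -> T X} :=
  [ffun h => if h == 1%g then t else 0].

Lemma prod_incl1_additive (X : gset G) : zmod_morphism (@prod_incl1_fun X).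
Proof.
by move=> a b; apply/ffunP=> h; rewrite !ffunE; case: ifP => // _; rewrite subr0.
Qed.
HB.instance Definition _ (X : gset G) :=
  GRing.isZmodMorphism.Build (T X) {ffun H -> T X} (@prod_incl1_fun X)
    (@prod_incl1_additive X).

Lemma prod_incl1_res (X Y : gset G) (f : gmap X Y) (t : mack T Y) :
  prod_incl1_fun (mk_res (mack T) f t)
    = mk_res (mack (prod_tambara H T)) f (prod_incl1_fun t).
Proof. by apply/ffunP=> h; rewrite !ffunE; case: ifP; rewrite ?raddf0. Qed.

Lemma prod_incl1_tr (X Y : gset G) (f : gmap X Y) (t : mack T X) :
  prod_incl1_fun (mk_tr (mack T) f t)
    = mk_tr (mack (prod_tambara H T)) f (prod_incl1_fun t).
Proof. by apply/ffunP=> h; rewrite !ffunE; case: ifP; rewrite ?raddf0. Qed.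

(** Only a map of Mackey functors in general: it sends 1 to the indicator of the
    identity of [H], which is the unit only if [H] or [T X] is trivial. *)
Definition prod_incl1 : mackey_map (mack T) (mack (prod_tambara H T)) :=
  @MackeyMap G (mack T) (mack (prod_tambara H T)) (fun X => @prod_incl1_fun X)
    prod_incl1_res prod_incl1_tr.

Lemma mulr_prod_incl1 (X : gset G) (b : {ffun H -> T X}) (t : T X) :
  b * prod_incl1 X t = prod_incl1 X (b 1%g * t).
Proof.
apply/ffunP=> h; rewrite !ffunE; case: eqP => [->|_] //.
by rewrite mulr0.
Qed.

End ComponentAtIdentity.

Theorem proposition6p6 (G H : finGroupType) (R T : tambara G)
    (phi : tambara_map R T) (act : algebra_action H phi) (B : relative_box phi) :
  galois_extension act B -> separable B.
Proof.
case=> _ _ [F [F' [FE FK F'K]]].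
exists (mm_comp (mack_map F') (prod_incl1 H T)); split; first split.
- move=> X a m /=; apply: (can_inj (FK X)).
  rewrite rmorphM !F'K FE [RHS]mulr_prod_incl1 galois_chi_rtens.
  by rewrite rmorph1 mulr1.
- move=> X m a /=; apply: (can_inj (FK X)).
  rewrite rmorphM !F'K FE [RHS]mulrC [RHS]mulr_prod_incl1 galois_chi_rtens.
  by rewrite alg_act1 mul1r mulrC.
move=> X t; rewrite -(galois_chi_at1 act) -FE /= F'K.
by rewrite ffunE eqxx.
Qed.
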